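(* Let $f\in\mathrm{F}$ and $(\tau,\xi)\in\mathbb{R}^2$ with $f(\tau,\xi)>0$. Let $\varphi$ be any maximal solution of the initial value problem $x'=f(t,x)$, $x(\tau)=\xi$; it is a strictly increasing bijection in some set $C^1([\tau,T_* ),[\xi,X_* ))$ with $T_*\in(\tau,\infty]$, $X_*=\lim_{t\uparrow T_*}\varphi(t)\in(\xi,\infty]$ and $T_*\vee X_*=\infty$. Then $$\inf_{x\in[\xi,\infty)}f(t,x)<0\ \ \forall t\in[\tau,\infty)\ \implies\ T_*=\infty,$$ $$\sup_{t\in[\tau,\infty)}f(t,x)>0\ \ \forall x\in[\xi,\infty)\ \implies\ X_*=\infty.$$
   Context: $\mathrm{F}\subset C(\mathbb{R}^2,\mathbb{R})$ is the set of continuous functions $f:\mathbb{R}^2\to\mathbb{R}$, $(t,x)\mapsto f(t,x)$, such that $f(\cdot,x)$ is strictly increasing for every $x\in\mathbb{R}$, and $f(\tau,\xi)>0$ for some $(\tau,\xi)\in\mathbb{R}^2$. A maximal solution of $x'=f(t,x)$, $x(\tau)=\xi$ (going forwards in time) is a path $\varphi\in C^1([\tau,T_* ),\mathbb{R})$ for some $T_*\in(\tau,\infty]$ (with a right derivative at $\tau$) which verifies $\varphi(\tau)=\xi$, $\varphi'(t)=f(t,\varphi(t))$ for every $t\in[\tau,T_* )$, and $T_*\vee\sup_{t\in[\tau,T_* )}|\varphi(t)|=\infty$. Here $a\vee b=\max\{a,b\}$. *)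

(* Defs.v *)
From mathcomp Require Import all_boot all_order all_algebra.
From mathcomp Require Import all_classical all_reals all_analysis.
Import Order.TTheory GRing.Theory Num.Theory.
Import numFieldNormedType.Exports.

Set Implicit Arguments.
Unset Strict Implicit.
Unset Printing Implicit Defensive.

Local Open Scope classical_set_scope.
Local Open Scope ring_scope.

Definition classF (R : realType) (f : R * R -> R) : Prop :=
  [/\ continuous f,
      forall x : R, {homo (fun t => f (t, x)) : s t / s < t} &
      exists tau xi : R, 0 < f (tau, xi)].

(* The half-open real interval [a, b[, whose right endpoint may be infinite. *)
Definition interval_co (R : realType) (a : R) (b : \bar R) : set R :=
  [set t | a <= t /\ (t%:E < b)%E].

(* The derivative of g at t relative to D. For D = [a, b[ it is the right
   derivative at t = a and the ordinary derivative at a < t < b. *)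
Definition is_derive_within (R : realType) (D : set R) (g : R -> R)
    (t l : R) : Prop :=
  (g s - g t) / (s - t) @[s --> within D t^'] --> l.

Definition C1_on (R : realType) (D : set R) (g : R -> R) : Prop :=
  exists g' : R -> R, {within D, continuous g'} /\
    forall t, D t -> is_derive_within D g t (g' t).

(* A path on [tau, T[ is represented by a total function, of which only the
   values on [tau, T[ matter. *)
Definition maximal_solution (R : realType) (f : R * R -> R) (tau xi : R)
    (T : \bar R) (phi : R -> R) : Prop :=
  let D := interval_co tau T in
  [/\ (tau%:E < T)%E,
      C1_on D phi,
      phi tau = xi,
      forall t, D t -> is_derive_within D phi t (f (t, phi t)) &
      maxe T (ereal_sup [set `|phi t|%:E | t in D]) = +oo%E].

(* The filter "t tends to T from below"; the value at T = -oo, where there is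
   nothing below T, is never used. *)
Definition below (R : realType) (T : \bar R) : set_system R :=
  match T with
  | x%:E => x^'-
  | +oo%E => pinfty_nbhs R
  | -oo%E => ninfty_nbhs R
  end.

(* Main.v *)
Require Import Defs.
From mathcomp Require Import all_boot all_order all_algebra.
From mathcomp Require Import all_classical all_reals all_analysis.
From mathcomp Require Import lra.
Import Order.TTheory GRing.Theory Num.Theory.
Import numFieldNormedType.Exports.

(** Since [f] increases in time, a level [x] crossed upwards by [phi] at time
    [t1] satisfies [0 <= f (t1, x) < f (t2, x)] for every later [t2], so it
    cannot be crossed downwards again; hence [phi] is nondecreasing. It is
    strictly so, because on an interval where [phi] is a constant [c] the
    strictly increasing map [f (., c)] would vanish. One cannot argue via
    [phi' > 0]: for f (t, x) = t + 3 sqrt (max (- x) 0) there is a strictly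
    increasing solution with [phi' 0 = 0].

    If [T] is finite then [X = +oo], so a level [x] with [f (T, x) < 0] is
    attained at some [t < T], where [0 <= f (t, x) < f (T, x)]. If [X] is finite
    then [T = +oo], and [f (s, X) > 0] would bound [phi'] from below by a
    positive constant near [X], making [phi] unbounded. *)

Set Implicit Arguments.
Unset Strict Implicit.
Unset Printing Implicit Defensive.

Local Open Scope classical_set_scope.
Local Open Scope ring_scope.

(** * Derivatives relative to a set, and level crossings *)

Lemma is_derive_within_continuous (R : realType) (D : set R) (g : R -> R)
    (t l : R) : is_derive_within D g t l -> g s @[s --> within D (nbhs t)] --> g t.
Proof.
move=> gl.
have idt : s @[s --> within D t^'] --> t.
  exact: cvg_trans (cvg_within _) (@cvg_within _ (nbhs t) _ _).
have subt : s - t @[s --> within D t^'] --> (0 : R).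
  by rewrite -(subrr t); apply: (cvgB idt); exact: cvg_cst.
have gD : g s @[s --> within D t^'] --> g t.
  (* Here [g s] is written as its difference quotient times [s - t], plus [g t]. *)
  have qs : (g s - g t) / (s - t) * (s - t) + g t @[s --> within D t^']
      --> l * 0 + g t.
    by apply: cvgD; [exact: cvgM|exact: cvg_cst].
  rewrite mulr0 add0r in qs; apply: cvg_trans qs; apply: near_eq_cvg.
  apply: filterS (nbhs_dnbhs_neq t) => s st _.
  by rewrite /= divfK ?subr_eq0// subrK.
move=> A Agt.
have : within D t^' (g @^-1` A) by exact: gD.
suff : within D t^' (g @^-1` A) -> within D (nbhs t) (g @^-1` A) by [].
apply: (@filterS _ (nbhs t)) => s sA Ds.
(* The punctured limit says nothing at [t] itself, but [A] is a neighbourhood of [g t]. *)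
have [->|st] := eqVneq s t; first exact: nbhs_singleton Agt.
exact: sA.
Qed.

Lemma is_derive_withinS (R : realType) (D E : set R) (g : R -> R) (t l : R) :
  E `<=` D -> is_derive_within D g t l -> is_derive_within E g t l.
Proof.
rewrite /is_derive_within => ED gl; apply: cvg_trans gl; apply: cvg_app => A; rewrite /= !nbhs_simpl /within /=.
by apply: filterS => s /[swap] /ED /[swap]; apply.
Qed.

Lemma is_derive_within_ge0 (R : realType) (g : R -> R) (t u l : R) :
  t < u -> is_derive_within `[t, u] g t l ->
  (forall s, t < s <= u -> g t <= g s) -> 0 <= l.
Proof.
move=> tu gl tug.
have : (g s - g t) / (s - t) @[s --> t^'+] --> l.
  apply: cvg_trans gl; apply: cvg_app => A.
  suff : within `[t, u] t^' A -> t^'+ A by [].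
  have : \forall s \near t, s < u by exact: lt_nbhsl.
  apply: (@filterS2 _ (nbhs t)) => s su + ts; apply; first by rewrite gt_eqF.
  by rewrite /= in_itv/= !ltW.
move=> /cvgr_to_ge; apply.
near=> s.
have ts : t < s by [].
apply: divr_ge0; rewrite subr_ge0; last exact: ltW.
by apply: tug; rewrite ts/=; near: s; exact: nbhs_right_le.
Unshelve. all: by end_near.
Qed.

(** The point is the supremum [c] of the set where [g <= x]. Continuity gives [g c <= x], and a
    solution of [g d = x] in [[c, b]] belongs to that set, hence is [c]. *)
Lemma last_hit (R : realType) (g : R -> R) (a b x : R) : a <= b ->
  {within `[a, b], continuous g} -> g a <= x < g b ->
  exists c, [/\ a <= c < b, g c = x & forall u, c < u <= b -> x < g u].
Proof.
move=> ab gab /andP[gax xgb].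
pose A := [set u | a <= u <= b /\ g u <= x].
have Aa : A a by rewrite /A /= lexx ab.
have Aub : ubound A b by move=> u [/andP[]].
have supA : has_sup A by split; [exists a|exists b].
set c := sup A.
have leA u : A u -> u <= c by exact: sup_upper_bound.
have ac : a <= c by exact: leA.
have cb : c <= b by exact: ge_sup supA.1 Aub.
have cI : c \in `[a, b] by rewrite in_itv/= ac cb.
have gcx : g c <= x.
  (* Otherwise [g] would exceed [x] near [c], yet [A] has points arbitrarily close to [c]. *)
  rewrite leNgt; apply/negP => xgc.
  have : \forall u \near within `[a, b] (nbhs c), x < g u.
    move/subspace_continuousP : gab => /(_ c cI) /cvgr_gt; exact.
  rewrite /within /= => -[e /= e0 ce].
  have [u [/andP[au ub] gux] ceu] := sup_adherent e0 supA.
  have uc : u <= c by apply: leA; split; rewrite // au.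
  have : x < g u.
    apply: (ce u); rewrite /= ?in_itv/= ?au//.
    by rewrite ger0_norm ?subr_ge0// ltrBlDl -ltrBlDr.
  by rewrite ltNge gux.
have gcE : g c = x.
  have : {within `[c, b], continuous g}.
    apply: continuous_subspaceW gab => u /=.
    by rewrite !in_itv/= => /andP[cu ->]; rewrite (le_trans ac cu).
  move=> /(IVT cb) - /(_ x).
  rewrite ge_min gcx le_max (ltW xgb) orbT => -[//|d].
  rewrite in_itv/= => /andP[cd db] gd.
  suff -> : c = d by [].
  apply/eqP; rewrite eq_le cd/=; apply: leA.
  by split; rewrite ?gd// db andbT (le_trans ac).
exists c; split => //.
  rewrite ac/= lt_neqAle cb andbT; apply/negP => /eqP cbE.
  by move: xgb; rewrite -cbE gcE ltxx.
move=> u /andP[cu ub]; rewrite ltNge; apply/negP => gux.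
suff : u <= c by rewrite leNgt cu.
by apply: leA; split; rewrite // ub (le_trans ac (ltW cu)).
Qed.

Lemma is_derive_within_le0 (R : realType) (g : R -> R) (t u l : R) :
  u < t -> is_derive_within `[u, t] g t l ->
  (forall s, u <= s < t -> g t <= g s) -> l <= 0.
Proof.
move=> ut gl utg.
have : (g s - g t) / (s - t) @[s --> t^'-] --> l.
  apply: cvg_trans gl; apply: cvg_app => A.
  suff : within `[u, t] t^' A -> t^'- A by [].
  have : \forall s \near t, u < s by exact: lt_nbhsr.
  apply: (@filterS2 _ (nbhs t)) => s su + ts; apply; first by rewrite lt_eqF.
  by rewrite /= in_itv/= !ltW.
move=> /cvgr_to_le; apply.
near=> s.
have ts : s < t by [].
apply: mulr_ge0_le0; last by rewrite invr_le0 subr_le0 ltW.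
by rewrite subr_ge0; apply: utg; rewrite ts andbT; near: s; exact: nbhs_left_ge.
Unshelve. all: by end_near.
Qed.

(** A bridge to the two-sided derivative that [MVT] expects: around an interior point, membership in
    [[a, b]] is automatic. *)
Lemma is_derive_within_itv (R : realType) (g : R -> R) (a b t l : R) :
  a < t < b -> is_derive_within `[a, b] g t l -> is_derive t 1 g l.
Proof.
move=> /andP[a_t tb] gl.
have shiftE : h + t @[h --> (0 : R)^'] --> within `[a, b] t^'.
  move=> A.
  suff : within `[a, b] t^' A -> (0 : R)^' [set h | A (h + t)] by [].
  have cvt : h + t @[h --> (0 : R)] --> t.
    rewrite -[X in _ --> X]add0r; apply: cvgD; [exact: cvg_id|exact: cvg_cst].
  have : \forall s \near t, a < s < b.
    by near=> s; apply/andP; split; near: s; [exact: lt_nbhsr|exact: lt_nbhsl].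
  move=> tab tA.
  suff : nbhs (0 : R) ((fun h => h + t) @^-1` ((fun s => a < s < b) `&`
      (fun s => s != t -> s \in `[a, b] -> A s))) ->
    (0 : R)^' [set h | A (h + t)] by apply; exact: cvt _ (filterI tab tA).
  apply: (@filterS _ (nbhs (0 : R))) => h /= [/andP[ah hb] hA] h0; apply: hA.
    by rewrite -subr_eq0 addrK.
  by rewrite in_itv/= !ltW.
have gl' : h^-1 *: ((g \o shift t) (h *: 1) - g t) @[h --> (0 : R)^'] --> l.
  apply: cvg_trans (cvg_comp _ _ shiftE gl).
  apply: near_eq_cvg; near=> h.
  by rewrite /= addrK [LHS]mulrC [h *: 1]mulr1.
apply: DeriveDef; last exact: cvg_lim gl'.
by apply/cvg_ex; exists l.
Unshelve. all: by end_near.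
Qed.

(** The reflection [u |-> - u] reduces this to [last_hit]. *)
Lemma first_hit (R : realType) (g : R -> R) (a b x : R) : a <= b ->
  {within `[a, b], continuous g} -> g b <= x < g a ->
  exists c, [/\ a < c <= b, g c = x & forall u, a <= u < c -> x < g u].
Proof.
move=> ab gab gx.
have := @last_hit _ (g \o -%R) (- b) (- a) x.
rewrite /= !opprK lerN2 => /(_ ab) [||c [/andP[bc ca] gc cg]] //.
  by apply: within_continuous_compN; rewrite !opprK.
exists (- c); split => //; first by rewrite ltrNr ca lerNl bc.
move=> u /andP[au uc]; rewrite -[u]opprK; apply: cg.
by rewrite ltrNr uc lerN2.
Qed.

(** Take [t1] as the last visit to level [x] before [s] and [t2] as the first one after it. Since
    [g] stays above [x] in between, the right derivative at [t1] and the left derivative at [t2]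
    have forced signs. *)
Lemma bump_derivatives (R : realType) (g dg : R -> R) (a b s x : R) :
  a <= s <= b -> (forall t, a <= t <= b -> is_derive_within `[a, b] g t (dg t)) ->
  g a <= x -> x < g s -> g b <= x ->
  exists t1 t2, [/\ a <= t1, t1 < t2, t2 <= b, g t1 = x /\ g t2 = x &
    0 <= dg t1 /\ dg t2 <= 0].
Proof.
move=> /andP[as_ sb] gdg gax xgs gbx.
have gc : {within `[a, b], continuous g}.
  apply/subspace_continuousP => t /=; rewrite in_itv/= => tab.
  exact: is_derive_within_continuous (gdg _ tab).
have [||t1 [/andP[at1 t1s] gt1 t1g]] := last_hit as_ (x := x) (g := g).
- apply: continuous_subspaceW gc => u /=; rewrite !in_itv/= => /andP[-> us].
  exact: le_trans us sb.
- by rewrite gax.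
have [||t2 [/andP[st2 t2b] gt2 t2g]] := first_hit sb (x := x) (g := g).
- apply: continuous_subspaceW gc => u /=; rewrite !in_itv/= => /andP[su ->].
  by rewrite (le_trans as_ su).
- by rewrite gbx.
exists t1, t2; split => //; first exact: lt_trans t1s st2.
split.
  apply: (@is_derive_within_ge0 _ g t1 s) => //.
    apply: is_derive_withinS (gdg _ _); last by rewrite at1 (le_trans (ltW t1s)).
    move=> u /=; rewrite !in_itv/= => /andP[t1u us].
    by rewrite (le_trans at1 t1u) (le_trans us sb).
  by move=> u /t1g/ltW; rewrite gt1.
apply: (@is_derive_within_le0 _ g t2 s) => //.
  apply: is_derive_withinS (gdg _ _); last by rewrite t2b (le_trans as_ (ltW _)).
  move=> u /=; rewrite !in_itv/= => /andP[su ut2].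
  by rewrite (le_trans as_ su) (le_trans ut2 t2b).
by move=> u /t2g/ltW; rewrite gt2.
Qed.

(** * Half-open intervals and their right ends *)

Lemma interval_co_down (R : realType) (a : R) (b : \bar R) (s t : R) :
  a <= s -> s <= t -> interval_co a b t -> interval_co a b s.
Proof. by move=> as_ st [_ tb]; split=> //; apply: le_lt_trans tb; rewrite lee_fin. Qed.

Lemma interval_co_gt (R : realType) (a : R) (b : \bar R) (t : R) :
  interval_co a b t -> exists2 u, t < u & interval_co a b u.
Proof.
case: b => [b| |] [/= at_ tb]; last by [].
- move: tb; rewrite lte_fin => tb; exists ((t + b) / 2); first by lra.
  by split; [lra|rewrite lte_fin; lra].
- by exists (t + 1); [lra|split; [lra|rewrite ltry]].
Qed.

Lemma near_below (R : realType) (a : R) (b : \bar R) (t : R) :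
  interval_co a b t -> \forall s \near below b, t < s /\ interval_co a b s.
Proof.
case: b => [b| |] [/= at_ tb]; last by [].
- near=> s; have ts : t < s by near: s; apply: nbhs_left_gt; rewrite -lte_fin.
  split => //; split; first exact: le_trans (ltW ts).
  by rewrite lte_fin; near: s; exact: nbhs_left_lt.
- near=> s; have ts : t < s by near: s; exact: nbhs_pinfty_gt.
  by split => //; split; [exact: le_trans (ltW ts)|rewrite ltry].
Unshelve. all: by end_near.
Qed.

(** * Monotonicity of a solution *)

Lemma solution_start (R : realType) (f : R * R -> R) (tau xi : R)
    (T : \bar R) (phi : R -> R) (t : R) :
  0 < f (tau, xi) -> maximal_solution f tau xi T phi ->
  tau < t -> interval_co tau T t ->
  exists2 s, tau < s < t & xi < phi s.
Proof.
move=> fpos [tauT _ phi0 dphi _] taut Dt.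
have Dtau : interval_co tau T tau by split.
(* The difference quotients at [tau] tend to [f (tau, xi) > 0], so they are positive just to the
   right of [tau]. *)
have := dphi _ Dtau; rewrite /is_derive_within phi0 => /cvgr_gt => /(_ _ fpos).
suff : within (interval_co tau T) tau^'
    [set s | 0 < (phi s - xi) / (s - tau)] ->
  exists2 s : R, tau < s < t & xi < phi s by [].
move=> q.
have : \forall s \near tau^'+, tau < s < t /\ 0 < (phi s - xi) / (s - tau).
  have ltt : nbhs tau (fun s => s < t) by exact: lt_nbhsl.
  suff : nbhs tau (fun s => tau < s -> tau < s < t /\ 0 < (phi s - xi) / (s - tau)).
    by [].
  apply: (@filterS2 _ (nbhs tau)) q ltt => s qs st taus; split; first by rewrite taus.
  apply: qs; first by rewrite gt_eqF.
  by apply: interval_co_down Dt; exact: ltW.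
move=> /filter_ex[s [/andP[taus st] qs]]; exists s; first by rewrite taus.
by move: qs; rewrite pmulr_lgt0 ?invr_gt0 subr_gt0.
Qed.

Lemma solution_nondecreasing (R : realType) (f : R * R -> R) (tau xi : R)
    (T : \bar R) (phi : R -> R) :
  (forall x, {homo (fun t => f (t, x)) : s t / s < t}) ->
  0 < f (tau, xi) -> maximal_solution f tau xi T phi ->
  forall s t, interval_co tau T s -> interval_co tau T t -> s <= t ->
  phi s <= phi t.
Proof.
move=> finc fpos sol s t Ds Dt st; have [_ _ phi0 dphi _] := sol.
rewrite leNgt; apply/negP => phits.
have {}st : s < t.
  by rewrite lt_neqAle st andbT; apply: contraTneq phits => ->; rewrite ltxx.
(* A peak [r] before [t] must top both [xi] and [phi t]. The time [s] serves if [xi < phi s];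
   otherwise [phi t < phi s <= xi], and the initial rise of [phi] supplies one. *)
have [r [taur rt xir tr]] : exists r, [/\ tau <= r, r < t, xi < phi r & phi t < phi r].
  have [xis|sxi] := ltP xi (phi s); first by exists s; split => //; case: Ds.
  have taut : tau < t by case: Ds => + _ => /le_lt_trans; apply.
  have [r /andP[taur rt] xir] := solution_start fpos sol taut Dt.
  exists r; split => //; first exact: ltW.
  exact: lt_trans phits (le_lt_trans sxi xir).
(* The level is halfway between the higher end value and the peak. *)
pose x := (Num.max xi (phi t) + phi r) / 2.
have maxr : Num.max xi (phi t) < phi r by rewrite gt_max xir.
have xm : Num.max xi (phi t) < x by rewrite /x; lra.
have xr : x < phi r by rewrite /x; lra.
move: xm; rewrite gt_max => /andP[xix tx].
have [|u||t1 [t2 [taut1 t12 t2t [p1 p2]]]] :=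
  @bump_derivatives _ phi (fun t => f (t, phi t)) tau t r x _ _ _ xr (ltW tx).
- by rewrite taur ltW.
- move=> /andP[tauu ut]; apply: is_derive_withinS (dphi _ _).
    move=> v /=; rewrite in_itv/= => /andP[tauv vt].
    exact: interval_co_down Dt.
  exact: interval_co_down Dt.
- by rewrite phi0 ltW.
(* Now [f (t2, x) <= 0 <= f (t1, x)] with [t1 < t2], against the growth of [f] in time. *)
rewrite p1 p2 => -[f1 f2].
by have := finc x _ _ t12; rewrite ltNge (le_trans f2 f1).
Qed.

(** The right derivative is used: a half-open interval leaves room to the right of each of its
    points, but none to the left of [tau]. *)
Lemma solution_rhs_ge0 (R : realType) (f : R * R -> R) (tau xi : R)
    (T : \bar R) (phi : R -> R) :
  (forall x, {homo (fun t => f (t, x)) : s t / s < t}) ->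
  0 < f (tau, xi) -> maximal_solution f tau xi T phi ->
  forall t, interval_co tau T t -> 0 <= f (t, phi t).
Proof.
move=> finc fpos sol t Dt; have [_ _ _ dphi _] := sol.
have [u tu Du] := interval_co_gt Dt.
have tD s : t <= s -> s <= u -> interval_co tau T s.
  by move=> ts su; apply: interval_co_down Du => //; case: Dt => /le_trans->.
apply: (is_derive_within_ge0 tu (is_derive_withinS _ (dphi _ Dt))).
  by move=> s /=; rewrite in_itv/= => /andP[]; exact: tD.
move=> s /andP[ts su]; apply: (solution_nondecreasing finc fpos sol) => //.
  exact: tD (ltW ts) su.
exact: ltW.
Qed.

Lemma solution_increasing (R : realType) (f : R * R -> R) (tau xi : R)
    (T : \bar R) (phi : R -> R) :
  (forall x, {homo (fun t => f (t, x)) : s t / s < t}) ->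
  0 < f (tau, xi) -> maximal_solution f tau xi T phi ->
  forall s t, interval_co tau T s -> interval_co tau T t -> s < t ->
  phi s < phi t.
Proof.
move=> finc fpos sol s t Ds Dt st; have [_ _ _ dphi _] := sol.
have mono := solution_nondecreasing finc fpos sol.
rewrite lt_neqAle mono ?ltW// andbT; apply/eqP => phist.
have sD u : s <= u -> u <= t -> interval_co tau T u.
  by move=> su ut; apply: interval_co_down Dt => //; case: Ds => /le_trans->.
(* On [[s, t]] the solution never drops below [phi s = phi t], so its left derivative at [t] is
   nonpositive; [solution_rhs_ge0] gives the opposite sign at [s], at the same level. *)
have : f (t, phi t) <= 0.
  apply: (is_derive_within_le0 st (is_derive_withinS _ (dphi _ Dt))).
    by move=> u /=; rewrite in_itv/= => /andP[]; exact: sD.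
  by move=> u /andP[su ut]; rewrite -phist; apply: mono => //; apply: sD (ltW _).
have := solution_rhs_ge0 finc fpos sol Ds.
rewrite phist => fs ft.
by have := finc (phi t) _ _ st; rewrite ltNge (le_trans ft fs).
Qed.

(** * Behaviour of a solution towards the end of its interval *)

Lemma below_filter (R : realType) (b : \bar R) : Filter (below b).
Proof. by case: b => [b| |] /=; typeclasses eauto. Qed.

(** Any bound below the supremum is passed by some value of [g], hence by all later ones. Working in
    the extended reals lets finite and infinite limits share one statement. *)
Lemma nondecreasing_cvg_below (R : realType) (a : R) (b : \bar R) (g : R -> R) :
  (a%:E < b)%E ->
  (forall s t, interval_co a b s -> interval_co a b t -> s <= t -> g s <= g t) ->
  (g t)%:E @[t --> below b] --> ereal_sup [set (g t)%:E | t in interval_co a b].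
Proof.
move=> ab gmono; set S := [set _ | _ in _]; set X := ereal_sup S.
have Da : interval_co a b a by split.
have FF := below_filter b.
have leX t : interval_co a b t -> ((g t)%:E <= X)%E.
  by move=> Dt; apply: ereal_sup_ubound; exists t.
have gX (y : \bar R) : (y < X)%E -> \forall t \near below b, (y < (g t)%:E <= X)%E.
  move=> /ereal_sup_gt[_ [t Dt <-]] yt; apply: filterS (near_below Dt) => s [ts Ds].
  by rewrite leX// andbT (lt_le_trans yt)// lee_fin; apply: gmono => //; exact: ltW.
have : (-oo < X)%E by exact: lt_le_trans (ltNyr _) (leX a Da).
case: X leX gX => [x| |] leX gX // _.
- apply: cvg_EFin; first exact: nearW.
  apply/cvgrPdist_lt => e e0; apply: filterS (gX (x - e)%:E _).
    move=> t; rewrite lte_fin lee_fin => /andP[xt tx] /=.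
    by rewrite ger0_norm ?subr_ge0// ltrBlDl -ltrBlDr.
  by rewrite lte_fin; lra.
- apply/cvgeyPge => A; apply: filterS (gX A%:E (ltry _)) => t /andP[At _].
  exact: ltW.
Qed.

Lemma solution_IVT (R : realType) (f : R * R -> R) (tau xi : R)
    (T : \bar R) (phi : R -> R) :
  maximal_solution f tau xi T phi ->
  forall t y, interval_co tau T t -> xi <= y <= phi t ->
  exists2 s, interval_co tau T s & phi s = y.
Proof.
move=> [_ _ phi0 dphi _] t y Dt /andP[xiy yt].
have taut : tau <= t by case: Dt.
have D u : u \in `[tau, t] -> interval_co tau T u.
  by rewrite in_itv/= => /andP[tauu ut]; exact: interval_co_down Dt.
have phic : {within `[tau, t], continuous phi}.
  apply/subspace_continuousP => u ut; apply: is_derive_within_continuous.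
  exact: is_derive_withinS D (dphi _ (D _ ut)).
have [|s st <-] := IVT taut phic (v := y).
  by rewrite phi0 ge_min xiy le_max yt orbT.
by exists s => //; exact: D.
Qed.

(** The two bounds on [phi] spell out convergence to [x] from below. If [f (s, x)] were positive,
    continuity would bound [f (s, .)] below by some [d > 0] near [x], and growth in time would carry
    this bound to all later times. *)
Lemma solution_lim_infinite (R : realType) (f : R * R -> R) (tau xi x : R)
    (phi : R -> R) (s : R) :
  continuous f -> (forall y, {homo (fun t => f (t, y)) : s t / s < t}) ->
  maximal_solution f tau xi +oo%E phi ->
  (forall t, tau <= t -> phi t < x) ->
  (forall e, 0 < e -> exists2 u, tau <= u & forall t, u <= t -> x - e < phi t) ->
  tau <= s -> f (s, x) <= 0.
Proof.
move=> fc finc [_ _ _ dphi _] phix phicvg taus; rewrite leNgt; apply/negP => fsx.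
pose d := f (s, x) / 2; have d0 : 0 < d by rewrite divr_gt0.
have [e e0 fd] : exists2 e, 0 < e & forall y, `|x - y| < e -> d < f (s, y).
  have cvx : f (s, y) @[y --> x] --> f (s, x).
    have sy : (s, y) @[y --> x] --> (s, x).
      have cs : s @[_ --> x] --> s by exact: cvg_cst.
      exact: cvg_pair cs (@cvg_id _ (nbhs x)).
    exact: cvg_comp _ _ sy (fc (s, x)).
  have df : d < f (s, x) by rewrite /d; lra.
  have := cvgr_gt _ cvx d df.
  by move=> [e /= e0 H]; exists e => // y xy; exact: H.
have [u tauu ux] := phicvg _ e0.
(* From [a] on, [phi] is within [e] of [x] and time is past [s]; climbing at rate [d] for a time
   [e / d] gains [e]. *)
pose a := Num.max u s; pose b := a + e / d.
have ua : u <= a by rewrite le_max lexx.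
have sa : s <= a by rewrite le_max lexx orbT.
have ab : a < b by rewrite /b ltrDl divr_gt0.
have Dab : `[a, b] `<=` interval_co tau +oo%E.
  move=> t /=; rewrite in_itv/= => /andP[at_ _]; split; last by rewrite ltry.
  by rewrite (le_trans tauu)// (le_trans ua).
have dphi' t : t \in `[a, b] -> is_derive_within `[a, b] phi t (f (t, phi t)).
  by move=> tab; exact: is_derive_withinS Dab (dphi _ (Dab _ tab)).
have [|||c] := @MVT _ phi (fun t => f (t, phi t)) a b.
- by [].
- move=> t tab; apply: is_derive_within_itv (dphi' _ _); first by rewrite in_itv in tab.
  exact: subset_itv_oo_cc tab.
- apply/subspace_continuousP => t tab; apply: is_derive_within_continuous.
  exact: dphi'.
rewrite in_itv/= => /andP[ac cb] phiE.
have tauc t : a <= t -> tau <= t by move=> at_; lra.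
have dc : d <= f (c, phi c).
  apply: le_trans (ltW (fd (phi c) _)) _.
    rewrite ger0_norm ?subr_ge0 ?ltW ?phix ?tauc ?ltW//.
    by rewrite ltrBlDl -ltrBlDr; apply: ux; lra.
  have : s <= c by lra.
  by rewrite le_eqVlt => /predU1P[->//|/finc/ltW]; exact.
have : e <= phi b - phi a.
  rewrite phiE /b addrC addKr.
  by apply: le_trans (ler_wpM2r _ dc); [rewrite mulrC divfK ?gt_eqF|rewrite divr_ge0 ?ltW].
(* A gain of [e] is too much: [phi] is already above [x - e] at [a] and still below [x] at [b]. *)
have := phix b (tauc _ (ltW ab)); have := ux a ua; lra.
Qed.

(** * Bijectivity onto the range, and the two criteria *)

Theorem mainTheorem2 (R : realType) (f : R * R -> R) (tau xi : R)
    (hf : classF f) (hpos : 0 < f (tau, xi))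
    (T : \bar R) (phi : R -> R) (hphi : maximal_solution f tau xi T phi) :
  exists X : \bar R,
    ((phi t)%:E @[t --> below T] --> X) /\
    (xi%:E < X)%E /\
    maxe T X = +oo%E /\
    C1_on (interval_co tau T) phi /\
    (forall s t : R, interval_co tau T s -> interval_co tau T t ->
       s < t -> phi s < phi t) /\
    set_bij (interval_co tau T) (interval_co xi X) phi /\
    ((forall t : R, tau <= t ->
        (ereal_inf [set (f (t, x))%:E | x in [set x | (xi <= x)%R]] < 0)%E) ->
      T = +oo%E) /\
    ((forall x : R, xi <= x ->
        (0 < ereal_sup [set (f (t, x))%:E | t in [set t | (tau <= t)%R]])%E) ->
      X = +oo%E).
Proof.
have [fc finc _] := hf; have sol := hphi.
have [tauT C1 phi0 dphi maxT] := hphi.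
have mono := solution_nondecreasing finc hpos sol.
have incr := solution_increasing finc hpos sol.
have Dtau : interval_co tau T tau by split.
pose X := ereal_sup [set (phi t)%:E | t in interval_co tau T].
have phiX t : interval_co tau T t -> ((phi t)%:E < X)%E.
  (* The interval has no last point, so a later, larger value makes the bound strict. *)
  move=> Dt; have [u tu Du] := interval_co_gt Dt.
  apply: (@lt_le_trans _ _ (phi u)%:E); first by rewrite lte_fin incr.
  by apply: ereal_sup_ubound; exists u.
have Xphi (y : \bar R) : (y < X)%E -> exists2 t, interval_co tau T t & (y < (phi t)%:E)%E.
  by move=> /ereal_sup_gt[_ [t Dt <-]] yt; exists t.
have xiphi t : interval_co tau T t -> xi <= phi t.
  by move=> Dt; rewrite -phi0; apply: mono => //; case: Dt.
have xiX : (xi%:E < X)%E by rewrite -phi0 phiX.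
have onto y : xi <= y -> (y%:E < X)%E -> exists2 t, interval_co tau T t & phi t = y.
  move=> xiy /Xphi[t Dt]; rewrite lte_fin => yt.
  by apply: solution_IVT sol _ _ Dt _; rewrite xiy ltW.
have TX : maxe T X = +oo%E.
  have [->|Too] := eqVneq T +oo%E; first by rewrite maxye.
  case XE : X xiX => [x| |] // _; last by rewrite maxey.
  (* With [T] and [X] both finite, [xi <= phi t < x] bounds [|phi t|] by [|xi| + |x|], against
     maximality. *)
  exfalso; move: maxT; apply/eqP; rewrite lt_eqF// gt_max ltey Too/=.
  apply: (@le_lt_trans _ _ (`|xi| + `|x|)%:E); last exact: ltry.
  apply: ge_ereal_sup => _ [t Dt <-]; rewrite lee_fin.
  have := xiphi t Dt; have := phiX t Dt; rewrite XE lte_fin => px xip.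
  rewrite ler_norml; have := ler_norm x; have := ler_norm (- xi).
  rewrite normrN; have := normr_ge0 x; have := normr_ge0 xi; lra.
exists X; split; first exact: nondecreasing_cvg_below.
do 5! (split => //).
- split.
  + by move=> t Dt; split; [exact: xiphi|exact: phiX].
  + move=> s t /[!inE] Ds Dt st; apply/eqP; rewrite eq_le !leNgt.
    apply/andP; split; apply/negP => lt_.
    * by have := incr _ _ Dt Ds lt_; rewrite st ltxx.
    * by have := incr _ _ Ds Dt lt_; rewrite st ltxx.
  + by move=> y [xiy yX]; have [t Dt <-] := onto _ xiy yX; exists t.
split=> [infneg|suppos].
- case TE : T tauT => [t| |] // tauT'.
  have Xoo : X = +oo%E.
    by move: TX; rewrite TE; case: (X) => [x| |] //; rewrite /Order.max; case: ifP.
  have taut : tau <= t by rewrite ltW// -lte_fin.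
  (* The hypothesis is applied at the end time [t], which lies outside the interval; the level [x]
     it provides is attained earlier because [X] is infinite. *)
  have [_ [x xix <-]] := ereal_inf_lt (infneg t taut); rewrite lte_fin => ftx.
  have [s Ds sx] := onto x xix ltac:(by rewrite Xoo ltry).
  have st : s < t by case: Ds => _; rewrite TE lte_fin.
  have := solution_rhs_ge0 finc hpos sol Ds; rewrite sx => fs.
  by have := lt_trans (finc x _ _ st) ftx; rewrite ltNge fs.
- case XE : X xiX => [x| |] // xiX'.
  have Too : T = +oo%E by move: TX; rewrite XE; case: (T) => [t| |] //; rewrite /Order.max; case: ifP.
  have xix : xi <= x by rewrite ltW// -lte_fin.
  (* Dually, the hypothesis is applied at the limit level [x], which [phi] approaches but never
     attains. *)
  have [_ [s taus <-]] := ereal_sup_gt (suppos x xix); rewrite lte_fin ltNge => /negP[].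
  have D t : tau <= t -> interval_co tau T t by rewrite Too => ?; split; rewrite // ltry.
  rewrite Too in sol; apply: (solution_lim_infinite fc finc sol _ _ taus) => [t taut|e e0].
    by rewrite -lte_fin -XE; apply/phiX/D.
  have [|u Du xu] := Xphi (x - e)%:E; first by rewrite XE lte_fin; lra.
  have tauu : tau <= u by case: Du.
  exists u => // t ut; rewrite -lte_fin (lt_le_trans xu)// lee_fin.
  by apply: mono => //; apply: D; exact: le_trans ut.
Qed.
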